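(* For $m\ge3$, the e-ADMM is not necessarily convergent for all $\beta>0$ when $(m-2)$ of the functions in the objective are strongly convex: for every $m\ge3$ and every $\beta>0$ there exist an instance of problem (P) with $m$ blocks in which exactly $m-2$ of the functions $\theta_1,\dots,\theta_m$ are strongly convex, and an initial point $(x_2^0,\dots,x_m^0,z^0)$, such that the sequence generated by the e-ADMM with penalty parameter $\beta$ does not converge.
   Context: Problem (P): minimize $\sum_{i=1}^m\theta_i(x_i)$ subject to $\sum_{i=1}^m A_ix_i=b$, $x_i\in\mathcal X_i$ ($i=1,\dots,m$), where $\theta_i:\mathbb R^{n_i}\to\mathbb R$ are closed proper convex functions, $A_i\in\mathbb R^{l\times n_i}$, $\mathcal X_i\subseteq\mathbb R^{n_i}$ are nonempty closed convex sets, $b\in\mathbb R^l$, and the solution set is nonempty. A function $f$ is strongly convex if for some $\mu>0$, $f(tx+(1-t)y)\le tf(x)+(1-t)f(y)-\frac{\mu}{2}t(1-t)\|x-y\|^2$ for all $x,y$ and $t\in[0,1]$. Augmented Lagrangian ($\beta>0$): $\mathcal L_\beta(x_1,\dots,x_m,z)=\sum_i\theta_i(x_i)-z^\top(\sum_iA_ix_i-b)+\frac{\beta}{2}\|\sum_iA_ix_i-b\|^2$, $z\in\mathbb R^l$. e-ADMM: from an initial $(x_2^0,\dots,x_m^0,z^0)$, for $k=0,1,2,\dots$ compute successively for $i=1,\dots,m$ $x_i^{k+1}=\arg\min\{\mathcal L_\beta(x_1^{k+1},\dots,x_{i-1}^{k+1},x_i,x_{i+1}^k,\dots,x_m^k,z^k):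 x_i\in\mathcal X_i\}$, and then $z^{k+1}=z^k-\beta(\sum_{i=1}^mA_ix_i^{k+1}-b)$. The generated sequence is $w^k=(x_1^k,\dots,x_m^k,z^k)$, $k\ge1$. *)

(* Defs.v *)
From HB Require Import structures.
From mathcomp Require Import all_boot all_order all_algebra.
From mathcomp Require Import all_classical all_reals all_analysis.
Import Order.TTheory GRing.Theory Num.Theory.
Import numFieldNormedType.Exports.

Set Implicit Arguments.
Unset Strict Implicit.
Unset Printing Implicit Defensive.

Local Open Scope classical_set_scope.
Local Open Scope ring_scope.

(* The library's norm on matrices is the sup norm, hence this definition. *)
Definition enorm (R : realType) (n : nat) (v : 'cV[R]_n) : R :=
  Num.sqrt (\sum_(j < n) v j 0 ^+ 2).

Definition argmin (R : realType) (T : Type) (f : T -> R) (D : set T) : set T :=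
  [set u | D u /\ forall v, D v -> f u <= f v].

Definition proper_fun (R : realType) (T : Type) (f : T -> \bar R) : Prop :=
  (exists x, (f x < +oo)%E) /\ (forall x, (-oo < f x)%E).

(* Closedness of a proper convex function is lower semicontinuity. *)
Definition closed_proper_convex (R : realType) (n : nat)
    (f : 'cV[R]_n -> R) : Prop :=
  [/\ lower_semicontinuous (EFin \o f),
      proper_fun (EFin \o f)
    & convex_function [set: 'cV[R]_n] f].

Definition strongly_convex (R : realType) (n : nat)
    (f : 'cV[R]_n -> R) : Prop :=
  exists2 mu : R, 0 < mu &
    forall (x y : 'cV[R]_n) (t : R), 0 <= t <= 1 ->
      f (t *: x + (1 - t) *: y) <=
        t * f x + (1 - t) * f y - mu / 2 * t * (1 - t) * enorm (x - y) ^+ 2.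

(* Blocks are indexed by 0, ..., m - 1 instead of 1, ..., m. *)
Record problem (R : realType) (m : nat) := Problem {
  rdim : nat;
  bdim : 'I_m -> nat;
  theta : forall i, 'cV[R]_(bdim i) -> R;
  mxA : forall i, 'M[R]_(rdim, bdim i);
  Xset : forall i, set 'cV[R]_(bdim i);
  rhs : 'cV[R]_rdim }.

Section Problem.
Context {R : realType} {m : nat} (P : problem R m).

Definition blocks : Type := forall i : 'I_m, 'cV[R]_(bdim P i).

Definition objective (x : blocks) : R := \sum_(i < m) theta (x i).

Definition residual (x : blocks) : 'cV[R]_(rdim P) :=
  \sum_(i < m) mxA P i *m x i - rhs P.

Definition feasible : set blocks :=
  [set x | residual x = 0 /\ forall i, Xset (x i)].

Definition solution_set : set blocks := argmin objective feasible.

(* Dimensions are positive: every function on R^0 is strongly convex. *)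
Definition problem_hyp : Prop :=
  [/\ (0 < rdim P)%N,
      forall i, (0 < bdim P i)%N,
      forall i, closed_proper_convex (@theta _ _ P i),
      forall i, [/\ @Xset _ _ P i !=set0, closed (@Xset _ _ P i)
                  & convex_set (@Xset _ _ P i)]
    & solution_set !=set0].

Definition num_strongly_convex : nat :=
  #|[pred i : 'I_m | `[< strongly_convex (@theta _ _ P i) >]]|.

Definition aug_lagrangian (beta : R) (x : blocks) (z : 'cV[R]_(rdim P)) : R :=
  objective x - (z^T *m residual x) 0 0 + beta / 2 * enorm (residual x) ^+ 2.

(* (xnew_0, ..., xnew_(i-1), u, xold_(i+1), ..., xold_(m-1)) *)
Definition gs_point (xnew xold : blocks) (i : 'I_m) (u : 'cV[R]_(bdim P i)) :
    blocks :=
  dfwith (fun j : 'I_m => if (j < i)%N then xnew j else xold j) i u.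

(* [(x k, z k)] for [k >= 1] are iterates produced from the initial point
   [(x0, z0)]. Block 0 of [x0] and of [x 0] is never read, so that the initial
   point really is (x0_1, ..., x0_(m-1), z0). *)
Definition eADMM_seq (beta : R) (x0 : blocks) (z0 : 'cV[R]_(rdim P))
    (x : nat -> blocks) (z : nat -> 'cV[R]_(rdim P)) : Prop :=
  [/\ forall i : 'I_m, (0 < i)%N -> x 0%N i = x0 i,
      z 0%N = z0
    & forall k : nat,
        (forall i : 'I_m,
          argmin (fun u => aug_lagrangian beta (gs_point (x k.+1) (x k) u) (z k))
                 (@Xset _ _ P i) (x k.+1 i)) /\
        z k.+1 = z k - beta *: residual (x k.+1)].

Definition seq_converges (x : nat -> blocks) (z : nat -> 'cV[R]_(rdim P)) :
    Prop :=
  (forall i : 'I_m, cvgn (fun k => x k i)) /\ cvgn z.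

End Problem.

(* Main.v *)
Require Import Defs.
From HB Require Import structures.
From mathcomp Require Import all_boot all_order all_algebra.
From mathcomp Require Import all_classical all_reals all_analysis.
From mathcomp Require Import ring lra.
Import Order.TTheory GRing.Theory Num.Theory.
Import numFieldNormedType.Exports.

Local Open Scope classical_set_scope.
Local Open Scope ring_scope.

(** With one-dimensional blocks, quadratic objective functions [c_i x^2], no
    bounds on the blocks and [b = 0], one round of the e-ADMM is a linear map
    of the state [(x_1, ..., x_(m-1), z)]. With two blocks, the convergence of
    the ADMM confines its eigenvalues to the open unit disk and the point 1;
    with three blocks nothing does. The instance below has three coupled blocks, and its linear map has an eigenvalue
    [lambda] with [|lambda| = 1] and [2 Re lambda = 7/4]: part of the state
    keeps rotating forever. This happens although [(0, 0)] is a saddle point of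
    the Lagrangian.

    How the instance arises. Write [e_i = 2 c_i / beta] and let [G = A^T A] be
    the Gram matrix of the columns of the constraints. Substituting
    [w^(k+1) = lambda w^k] in the optimality conditions and in the multiplier
    update, and eliminating [z], leaves a linear system for [x] with matrix
    entries [G_ij] for [j < i], [G_ii + e_i (1 - 1/lambda)] on the diagonal
    and [kappa G_ij] for [j > i], where [kappa = 1 - (1 - 1/lambda)^2]. For
    three blocks with [e_1 = e_2 = 0], the vanishing of its determinant is a
    linear equation over the complex numbers in the two real unknowns [G_00]
    and [e_0], once [lambda] and the other entries of [G] are chosen. For
    [2 Re lambda = 7/4] and [a_1], [a_2] as below, this gives [e_0 = 2] and
    [G_00 = 86 = 8^2 + 2^2 + 3^2 + 3^2], and [G] is positive semidefinite, as
    it has to be. Only block 0 of the three is strongly convex. Any further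
    block gets the strongly convex function [beta x^2] and a zero column, so
    that it does not interact with the others. The factor [beta] in the weights
    makes the construction work for every penalty: measuring [z] in units of
    [beta] removes [beta] from the iteration.

    No eigenvector is needed to conclude. The linear form [probe] spans, with
    its image under the iteration, the left invariant plane that belongs to
    [lambda] and its conjugate, so its values [u_k] satisfy
    [u_(k+2) = 7/4 u_(k+1) - u_k] ([probe_recurrence]). Such a sequence
    converges only if it is zero ([linear_recurrence_not_cvg]). The optimality
    conditions are equivalent to a vanishing gradient ([argmin_gs_pointP]),
    which makes this apply to every sequence that the method can generate. *)

(** * Preliminaries on real numbers *)

(** A nonzero orbit of a rotation does not converge. The characteristic roots
    have product 1 and, as [`|t| < 2], are not real, so
    [u_k^2 + u_(k+1)^2 - t u_k u_(k+1)] is a positive definite form that the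
    recurrence preserves. A limit of [u] has to be 0, because 1 is not a root,
    and this would force the invariant to vanish. *)
Lemma linear_recurrence_not_cvg (R : realType) (t : R) (u : nat -> R) :
  `|t| < 2 -> u 0%N != 0 ->
  (forall k, u k.+2 = t * u k.+1 - u k) -> ~ cvgn u.
Proof.
move=> /ltr_normlP[tN2 t2] u0 uS cu; set L := lim (u @ \oo).
have uL : u @ \oo --> L by exact: cu.
have uSL : (fun k => u k.+1) @ \oo --> L by rewrite (cvg_shiftS u).
have uSSL : (fun k => u k.+2) @ \oo --> L.
  by rewrite (cvg_shiftS (fun k => u k.+1)).
have L0 : L = 0.
  have : (fun k => u k.+2) @ \oo --> t * L - L.
    under eq_fun do rewrite uS.
    by apply: cvgB => //; exact: cvgMl_tmp.
  move/(cvg_unique (@norm_hausdorff _ _))/(_ uSSL) => e.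
  have /eqP : (2 - t) * L = 0 by lra.
  by rewrite mulf_eq0 => /orP[/eqP ?|/eqP //]; lra.
pose Q k := u k ^+ 2 + u k.+1 ^+ 2 - t * (u k * u k.+1).
have QE k : Q k = Q 0%N.
  by elim: k => // k <-; rewrite /Q uS; ring.
have Q0 : Q @ \oo --> (0 : R).
  have -> : (0 : R) = L ^+ 2 + L ^+ 2 - t * (L * L) by rewrite L0; ring.
  apply: cvgB; last by apply: cvgMl_tmp; exact: cvgM.
  by apply: cvgD; rewrite expr2; exact: cvgM.
have : Q @ \oo --> Q 0%N.
  rewrite (_ : Q = fun=> Q 0%N); first exact: cvg_cst.
  exact/funext.
move/(cvg_unique (@norm_hausdorff _ _))/(_ Q0); rewrite /Q => q0.
(* Completing the square: the invariant is
   (u_1 - t/2 u_0)^2 + (2 - t) (2 + t) / 4 * u_0^2. *)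
have : 0 < u 0%N ^+ 2 by rewrite exprn_even_gt0.
have : 0 <= (u 1%N - t / 2 * u 0%N) ^+ 2 by exact: sqr_ge0.
have : 0 < (2 - t) * (2 + t) by apply: mulr_gt0; lra.
nra.
Qed.

Lemma quadratic_min0 (R : realType) (p g : R) : 0 < p ->
  (forall d, 0 <= d * g + d ^+ 2 * p) <-> g = 0.
Proof.
move=> p0; split=> [h|-> d]; last by rewrite mulr0 add0r mulr_ge0 ?sqr_ge0 ?ltW.
have := h (- g / (2 * p)).
have -> : - g / (2 * p) * g + (- g / (2 * p)) ^+ 2 * p = - (g ^+ 2 / (4 * p)).
  by field; rewrite gt_eqF.
rewrite oppr_ge0 pmulr_lle0 ?invr_gt0 ?mulr_gt0 // => g2.
by apply/eqP; rewrite -sqrf_eq0 eq_le g2 sqr_ge0.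
Qed.

Lemma conv_sqr (R : realType) (t a b : R) :
  (t * a + (1 - t) * b) ^+ 2 =
  t * a ^+ 2 + (1 - t) * b ^+ 2 - t * (1 - t) * (a - b) ^+ 2.
Proof. by ring. Qed.

Lemma enorm_sqr (R : realType) (n : nat) (v : 'cV[R]_n) :
  enorm v ^+ 2 = \sum_(j < n) v j 0 ^+ 2.
Proof. by rewrite /enorm sqr_sqrtr // sumr_ge0 // => j _; exact: sqr_ge0. Qed.

(** * Existence of e-ADMM sequences *)

Section wellposed.
Context {R : realType} {m : nat} (P : problem R m) (beta : R).

Lemma gs_point_congr (xn xn' xo : blocks P) (i : 'I_m) (u : 'cV[R]_(bdim P i)) :
  (forall j : 'I_m, (j < i)%N -> xn j = xn' j) ->
  gs_point xn xo u = gs_point xn' xo u.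
Proof.
move=> e; rewrite /gs_point; apply: functional_extensionality_dep => j.
by rewrite /dfwith; case: eqP => // _; case: ifP => //; exact: e.
Qed.

(** A sweep refers to its own result, since block [i] is computed from the new
    blocks [j < i]. It is built one block at a time: setting block [n] does not
    affect the subproblems of the blocks [i <= n], by [gs_point_congr]. *)
Lemma eADMM_seq_exists :
  (forall (i : 'I_m) (xn xo : blocks P) (z : 'cV[R]_(rdim P)), exists u,
    argmin (fun u => aug_lagrangian beta (gs_point xn xo u) z)
           (@Xset _ _ P i) u) ->
  forall (x0 : blocks P) (z0 : 'cV[R]_(rdim P)),
    exists x z, eADMM_seq beta x0 z0 x z.
Proof.
move=> solv x0 z0.
have sweep (w : blocks P * 'cV[R]_(rdim P)) : exists x' : blocks P, forall i,
    argmin (fun u => aug_lagrangian beta (gs_point x' w.1 u) w.2)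
           (@Xset _ _ P i) (x' i).
  suff build n : (n <= m)%N ->
      exists x' : blocks P, forall i : 'I_m, (i < n)%N ->
      argmin (fun u => aug_lagrangian beta (gs_point x' w.1 u) w.2)
             (@Xset _ _ P i) (x' i).
    by have [x' hx'] := build m (leqnn m); exists x' => i; exact: hx'.
  elim: n => [_|n IH nm]; first by exists w.1.
  have [x' hx'] := IH (ltnW nm).
  pose i0 := Ordinal nm.
  have [u hu] := solv i0 x' w.1 w.2.
  exists (dfwith x' i0 u) => i; rewrite ltnS => ilen.
  have -> : (fun v => aug_lagrangian beta (gs_point (dfwith x' i0 u) w.1 v) w.2)
          = (fun v : 'cV[R]_(bdim P i) =>
              aug_lagrangian beta (gs_point x' w.1 v) w.2).
    apply/funext => v; rewrite (@gs_point_congr _ x') // => j ji.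
    rewrite dfwithout //; apply: contraTneq ji => <-.
    by rewrite -leqNgt.
  have [<-|ine] := eqVneq i0 i; first by rewrite dfwithin.
  rewrite dfwithout //; apply: hx'.
  by rewrite ltn_neqAle ilen andbT; apply: contra ine => /eqP e; apply/eqP/val_inj.
have [f fP] := choice sweep.
pose next w := (f w, w.2 - beta *: residual (f w)).
pose w k := iter k next (x0, z0).
exists (fun k => (w k).1), (fun k => (w k).2).
by split => // k; split => // i; exact: fP.
Qed.

End wellposed.

(** * Quadratic problems with scalar blocks *)

Section quadratic.
Context {R : realType} {l m : nat} (c : 'I_m -> R) (A : 'M[R]_(l, m)).

Definition quadratic_problem : problem R m :=
  @Problem R m l (fun=> 1%N) (fun i x => c i * x 0 0 ^+ 2)
    (fun i => col i A) (fun=> setT) 0.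

Let P := quadratic_problem.

Definition coords (x : blocks P) : 'cV[R]_m := \col_i x i 0 0.

Lemma quadratic_residualE (x : blocks P) : residual x = A *m coords x.
Proof.
rewrite /residual subr0; apply/matrixP => t j; rewrite summxE !mxE.
by apply: eq_bigr => i _; rewrite !mxE big_ord1 mxE (ord1 j).
Qed.

Lemma strongly_convex_quadratic i :
  strongly_convex (@theta _ _ P i) <-> 0 < c i.
Proof.
(* The inequality between the points 1 and 0 at t = 1/2 reads mu <= 2 c_i. *)
split=> [[mu mu0 /(_ (const_mx 1) 0 (1 / 2))]|ci].
  rewrite enorm_sqr /= big_ord1 !mxE => /(_ _).
  have -> : 0 <= (1 / 2 : R) <= 1 by lra.
  by move=> /(_ isT); nra.
exists (2 * c i) => [|x y t t01]; first exact: mulr_gt0.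
rewrite enorm_sqr /= big_ord1 !mxE conv_sqr.
by rewrite le_eqVlt; apply/orP; left; apply/eqP; field.
Qed.

Lemma num_strongly_convex_quadratic :
  num_strongly_convex P = #|[pred i | 0 < c i]|.
Proof.
rewrite /num_strongly_convex; apply: eq_card => i; rewrite !inE.
by apply/asboolP/idP; move/strongly_convex_quadratic.
Qed.

Lemma closed_proper_convex_quadratic i :
  0 <= c i -> closed_proper_convex (@theta _ _ P i).
Proof.
move=> ci0; split.
- have cf : continuous (@theta _ _ P i : 'cV[R]_1 -> R).
    have -> : (@theta _ _ P i : 'cV[R]_1 -> R) =
        (fun x => c i * (x 0 0 * x 0 0)).
      by apply/funext => x; rewrite /= expr2.
    move=> x.
    have x00 : (fun y : 'cV[R]_1 => y 0 0) @ x --> x 0 0.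
      exact: coord_continuous.
    exact: (cvgMl_tmp (cvgM x00 x00)).
  move=> x a; rewrite lte_fin => ax.
  exists [set y | a < @theta _ _ P i y] => [|y]; last by rewrite lte_fin.
  exact: (cvgr_gt _ (cf x) _ ax).
- by split=> [|x]; [exists 0; rewrite ltry|rewrite ltNyr].
- move=> t x y _ _ /=.
  rewrite /conv /= !mxE; set a : R := x 0 0; set b : R := y 0 0.
  change (c i * (t%:num * a + (1 - t%:num) * b) ^+ 2 <=
          t%:num * (c i * a ^+ 2) + (1 - t%:num) * (c i * b ^+ 2)).
  have t0 : 0 <= t%:num by exact: ge0.
  have t1 : 0 <= 1 - t%:num by rewrite subr_ge0; exact: le1.
  have : 0 <= c i * (t%:num * (1 - t%:num) * (a - b) ^+ 2).
    by apply: mulr_ge0 => //; apply: mulr_ge0; [exact: mulr_ge0|exact: sqr_ge0].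
  by rewrite conv_sqr; nra.
Qed.

Lemma problem_hyp_quadratic :
  (forall i, 0 <= c i) -> (0 < l)%N -> problem_hyp P.
Proof.
move=> c_ge0 l0; split => // [i|i|].
- exact: closed_proper_convex_quadratic.
- by split; [exists 0|exact: closedT|move=> x y t _ _; rewrite inE].
- exists (fun=> 0); split=> [|x _].
    by split=> //; rewrite /residual subr0 big1 // => i _; exact: mulmx0.
  rewrite /objective big1; last by move=> i _; rewrite /= mxE expr0n mulr0.
  by apply: sumr_ge0 => i _; rewrite mulr_ge0 ?sqr_ge0.
Qed.

(** Half the second derivative of the augmented Lagrangian in block [i]. *)
Definition curvature (beta : R) (i : 'I_m) : R :=
  c i + beta / 2 * \sum_(t < l) A t i ^+ 2.

(** Partial derivative of the augmented Lagrangian in block [i] at [(y, z)]. *)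
Definition gradient (beta : R) (y : 'cV[R]_m) (z : 'cV[R]_l) (i : 'I_m) : R :=
  2 * c i * y i 0 + \sum_(t < l) A t i * (beta * (A *m y) t 0 - z t 0).

(** The second-order Taylor expansion in block [i], which is exact. *)
Lemma aug_lagrangian_shift (beta d : R) (x x' : blocks P) (z : 'cV[R]_l) i :
  coords x' = coords x + d *: delta_mx i 0 ->
  aug_lagrangian beta x' z = aug_lagrangian beta x z +
    (d * gradient beta (coords x) z i + d ^+ 2 * curvature beta i).
Proof.
move=> xx'.
have x'E j : x' j 0 0 = x j 0 0 + d * (j == i)%:R.
  by have /matrixP/(_ j 0) := xx'; rewrite !mxE eqxx andbT.
have objE : objective x' =
    objective x + (d * (2 * c i * x i 0 0) + d ^+ 2 * c i).
  rewrite /objective (bigD1 i) //= [in RHS](bigD1 i) //= x'E eqxx mulr1.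
  rewrite (eq_bigr (fun j => c j * x j 0 0 ^+ 2)) => [|j /negPf ji].
    by ring.
  by rewrite x'E ji mulr0 addr0.
have resE t : residual x' t 0 = residual x t 0 + d * A t i.
  by rewrite !quadratic_residualE xx' mulmxDr -scalemxAr -colE !mxE; ring.
have linE : (z^T *m residual x') 0 0 =
    (z^T *m residual x) 0 0 + d * \sum_t A t i * z t 0.
  rewrite !mxE mulr_sumr -big_split; apply: eq_bigr => t _ /=.
  by rewrite resE mxE; ring.
have sqE : \sum_t residual x' t 0 ^+ 2 = \sum_t residual x t 0 ^+ 2 +
    (2 * d * \sum_t A t i * residual x t 0 + d ^+ 2 * \sum_t A t i ^+ 2).
  rewrite !mulr_sumr -!big_split; apply: eq_bigr => t _ /=.
  by rewrite resE; ring.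
have gradE : gradient beta (coords x) z i = 2 * c i * x i 0 0 +
    (beta * \sum_t A t i * residual x t 0 - \sum_t A t i * z t 0).
  rewrite /gradient mxE mulr_sumr -sumrB; congr (_ + _).
  by apply: eq_bigr => t _; rewrite quadratic_residualE; ring.
by rewrite /aug_lagrangian objE linE !enorm_sqr sqE gradE /curvature; field.
Qed.

Lemma coords_gs_point (xn xo : blocks P) (i : 'I_m) (u : 'cV[R]_(bdim P i))
    (j : 'I_m) :
  coords (gs_point xn xo u) j 0 =
  if j == i then u 0 0 else if (j < i)%N then xn j 0 0 else xo j 0 0.
Proof.
rewrite mxE /gs_point; have [->|ji] := eqVneq j i; first by rewrite dfwithin.
by rewrite dfwithout 1?eq_sym //; case: ifP.
Qed.

Lemma aug_lagrangian_gs_point (beta : R) (xn xo : blocks P) (z : 'cV[R]_l)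
    (i : 'I_m) (u v : 'cV[R]_1) :
  let g := gradient beta (coords (gs_point xn xo (u : 'cV[R]_(bdim P i)))) z i in
  let d := v 0 0 - u 0 0 in
  aug_lagrangian beta (gs_point xn xo (v : 'cV[R]_(bdim P i))) z =
  aug_lagrangian beta (gs_point xn xo (u : 'cV[R]_(bdim P i))) z +
  (d * g + d ^+ 2 * curvature beta i).
Proof.
apply: aug_lagrangian_shift; apply/matrixP => j k.
rewrite (ord1 k) [RHS]mxE !coords_gs_point !mxE eqxx andbT.
by case: eqP => _; rewrite ?mulr1 ?mulr0 ?addr0 // addrC subrK.
Qed.

(** Positive curvature makes each subproblem the minimization of a strictly convex
    quadratic function of one variable. *)
Section positive_curvature.
Variable beta : R.
Hypothesis curv : forall i, 0 < curvature beta i.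

Lemma argmin_gs_pointP (xn xo : blocks P) (z : 'cV[R]_l) (i : 'I_m)
    (u : 'cV[R]_1) :
  argmin (fun v : 'cV[R]_(bdim P i) => aug_lagrangian beta (gs_point xn xo v) z)
    (@Xset _ _ P i) u <->
  gradient beta (coords (gs_point xn xo (u : 'cV[R]_(bdim P i)))) z i = 0.
Proof.
rewrite -(quadratic_min0 _ _ _ (curv i)); split=> [[_ umin] d|g0].
  have := umin (const_mx (u 0 0 + d)) I.
  rewrite (aug_lagrangian_gs_point _ _ _ _ _ u (const_mx _)) lerDl mxE.
  by rewrite addrAC subrr add0r.
split=> // v _.
by rewrite (aug_lagrangian_gs_point _ _ _ _ _ u v) lerDl; exact: g0.
Qed.

Lemma argmin_gs_point_exists (i : 'I_m) (xn xo : blocks P) (z : 'cV[R]_l) :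
  exists u, argmin
    (fun v : 'cV[R]_(bdim P i) => aug_lagrangian beta (gs_point xn xo v) z)
    (@Xset _ _ P i) u.
Proof.
pose g := gradient beta (coords (gs_point xn xo (0 : 'cV[R]_(bdim P i)))) z i.
pose p := curvature beta i.
have p0 : p != 0 by rewrite gt_eqF ?curv.
exists (const_mx (- g / (2 * p))); split=> // v _.
rewrite (aug_lagrangian_gs_point _ _ _ _ _ 0 v).
rewrite (aug_lagrangian_gs_point _ _ _ _ _ 0 (const_mx _)).
rewrite lerD2l !mxE !subr0 -/g -/p -subr_ge0; set d := v 0 0.
rewrite [leRHS](_ : _ = p * (d + g / (2 * p)) ^+ 2); last by field.
by rewrite mulr_ge0 ?sqr_ge0 // ltW ?curv.
Qed.

End positive_curvature.

End quadratic.

Arguments coords {R l m c A} x.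

(** * A rotating instance *)

Section rotating.
Context {R : realType} (n : nat) (beta : R).
Hypothesis beta0 : 0 < beta.

(** Columns [(8, 2, 3, 3)], [(1, 0, 0, 0)], [(2, 1, 0, 0)], and then zeros,
    which are the default values of [nth]. The Gram matrix of the first three
    columns has rows [(86, 8, 18)], [(8, 1, 2)], [(18, 2, 5)]. *)
Definition rotating_mx : 'M[R]_(4, n.+3) :=
  \matrix_(t, i) nth 0 (nth [::]
    [:: [:: 8; 1; 2]; [:: 2; 0; 1]; [:: 3]; [:: 3]] t) i.

Definition rotating_weight (i : 'I_n.+3) : R :=
  if (0 < i < 3)%N then 0 else beta.

Definition rotating_problem : problem R n.+3 :=
  quadratic_problem rotating_weight rotating_mx.

Let i0 : 'I_n.+3 := inord 0.
Let i1 : 'I_n.+3 := inord 1.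
Let i2 : 'I_n.+3 := inord 2.
Let t0 : 'I_4 := inord 0.
Let t1 : 'I_4 := inord 1.
Let t2 : 'I_4 := inord 2.
Let t3 : 'I_4 := inord 3.

Lemma sum_ord4 (F : 'I_4 -> R) : \sum_t F t = F t0 + F t1 + F t2 + F t3.
Proof.
rewrite 4!big_ord_recl big_ord0 addr0 !addrA.
by do !congr (_ + _); congr F; apply: val_inj; rewrite /= inordK.
Qed.

Lemma sum_first3 (F : 'I_n.+3 -> R) :
  (forall i : 'I_n.+3, (2 < i)%N -> F i = 0) ->
  \sum_i F i = F i0 + F i1 + F i2.
Proof.
move=> F0; rewrite 3!big_ord_recl big1 => [|i _]; last exact: F0.
rewrite addr0 !addrA.
by do !congr (_ + _); congr F; apply: val_inj; rewrite /= inordK.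
Qed.

Lemma rotating_weight_ge0 i : 0 <= rotating_weight i.
Proof. by rewrite /rotating_weight; case: ifP => // _; exact: ltW. Qed.

Lemma rotating_curvature i : 0 < curvature rotating_weight rotating_mx beta i.
Proof.
have S0 : 0 <= \sum_(t < 4) rotating_mx t i ^+ 2.
  by apply: sumr_ge0 => t _; exact: sqr_ge0.
have b2 : 0 <= beta / 2 by rewrite divr_ge0 ?ltW.
rewrite /curvature /rotating_weight; case: ifP => [i12|_]; last first.
  by rewrite ltr_pwDl // mulr_ge0.
rewrite add0r mulr_gt0 ?divr_gt0 // sum_ord4 !mxE !inordK //.
by case: i i12 {S0} => [[|[|[|i]]] hi] //= _; rewrite ?expr0n /= ?expr1n; lra.
Qed.

Lemma num_strongly_convex_rotating :
  num_strongly_convex rotating_problem = n.+1.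
Proof.
rewrite num_strongly_convex_quadratic -sum1_card big_mkcond /=.
rewrite 3!big_ord_recl !inE /rotating_weight /= beta0 ltxx.
rewrite (eq_bigr (fun=> 1%N)) => [|i _]; first by rewrite sum1_card card_ord.
by rewrite !inE beta0.
Qed.

Lemma rotating_mulmx (y : 'cV[R]_n.+3) t :
  (rotating_mx *m y) t 0 = rotating_mx t i0 * y i0 0 +
    rotating_mx t i1 * y i1 0 + rotating_mx t i2 * y i2 0.
Proof.
rewrite mxE sum_first3 // => i; rewrite mxE.
case: i => [[|[|[|i]]] hi] //= _; case: t => [[|[|[|[|t]]]] ht] //=;
by rewrite ?nth_nil mul0r.
Qed.

(** One round of the method in coordinates: the vanishing of the gradient in
    blocks 0, 1 and 2, and the multiplier update. *)
Lemma rotating_sweep x0 z0 (x : nat -> blocks rotating_problem) z k :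
  eADMM_seq beta x0 z0 x z ->
  let a := x k.+1 i0 0 0 in
  let b := x k i1 0 0 in let b' := x k.+1 i1 0 0 in
  let c := x k i2 0 0 in let c' := x k.+1 i2 0 0 in
  [/\ 2 * beta * a + 8 * (beta * (8 * a + b + 2 * c) - z k t0 0) +
        2 * (beta * (2 * a + c) - z k t1 0) +
        3 * (beta * (3 * a) - z k t2 0) + 3 * (beta * (3 * a) - z k t3 0) = 0,
      beta * (8 * a + b' + 2 * c) - z k t0 0 = 0,
      2 * (beta * (8 * a + b' + 2 * c') - z k t0 0) +
        (beta * (2 * a + c') - z k t1 0) = 0
    & [/\ z k.+1 t0 0 = z k t0 0 - beta * (8 * a + b' + 2 * c'),
          z k.+1 t1 0 = z k t1 0 - beta * (2 * a + c'),
          z k.+1 t2 0 = z k t2 0 - beta * (3 * a)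
        & z k.+1 t3 0 = z k t3 0 - beta * (3 * a)]].
Proof.
move=> [_ _ /(_ k) [opt zS]] a b b' c c'.
have e0 : i0 = 0%N :> nat by rewrite inordK.
have e1 : i1 = 1%N :> nat by rewrite inordK.
have e2 : i2 = 2%N :> nat by rewrite inordK.
have stat i := (argmin_gs_pointP rotating_weight rotating_mx beta
  rotating_curvature (x k.+1) (x k) (z k) i (x k.+1 i)).1 (opt i).
split.
- have := stat i0; rewrite /gradient sum_ord4 !rotating_mulmx !coords_gs_point.
  rewrite -!val_eqE /rotating_weight !mxE /= !e0 !e1 !e2 !inordK //= => h.
  by rewrite /a /b /c; lra.
- have := stat i1; rewrite /gradient sum_ord4 !rotating_mulmx !coords_gs_point.
  rewrite -!val_eqE /rotating_weight !mxE /= !e0 !e1 !e2 !inordK //= => h.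
  by rewrite /a /b' /c; lra.
- have := stat i2; rewrite /gradient sum_ord4 !rotating_mulmx !coords_gs_point.
  rewrite -!val_eqE /rotating_weight !mxE /= !e0 !e1 !e2 !inordK //= => h.
  by rewrite /a /b' /c'; lra.
- have zE t : z k.+1 t 0 = z k t 0 - beta * (rotating_mx *m coords (x k.+1)) t 0.
    by rewrite zS quadratic_residualE !mxE.
  rewrite /a /b' /c'.
  by split; rewrite zE rotating_mulmx !mxE !e0 !e1 !e2 !inordK //=; ring.
Qed.

(** A linear form on the left invariant plane of the eigenvalues of modulus 1.
    With [h = A^T z] it is [3 h_0 - 32 h_1 + beta (8 x_1 + 50 x_2)]. *)
Definition probe (x : blocks rotating_problem) (z : 'cV[R]_4) : R :=
  beta * (8 * x i1 0 0 + 50 * x i2 0 0) +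
  (6 * z t1 0 + 9 * z t2 0 + 9 * z t3 0 - 8 * z t0 0).

Lemma probe_recurrence x0 z0 x z k :
  eADMM_seq beta x0 z0 x z ->
  probe (x k.+2) (z k.+2) =
  7 / 4 * probe (x k.+1) (z k.+1) - probe (x k) (z k).
Proof.
move=> xz; rewrite /probe.
have [a0 a1 a2 [b0 b1 b2 b3]] := rotating_sweep _ _ _ _ k xz.
have [c0 c1 c2 [d0 d1 d2 d3]] := rotating_sweep _ _ _ _ k.+1 xz.
lra.
Qed.

Lemma probe_cvg x z : seq_converges x z -> cvgn (fun k => probe (x k) (z k)).
Proof.
move=> [cx cz].
have xc i : cvgn (fun k => x k i 0 0).
  apply/cvg_ex; exists (lim ((fun k => x k i) @ \oo) 0 0).
  by apply: (continuous_cvg _ (@coord_continuous R 1 1 0 0 _)); exact: cx.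
have zc t : cvgn (fun k => z k t 0).
  apply/cvg_ex; exists (lim (z @ \oo) t 0).
  by apply: (continuous_cvg _ (@coord_continuous R 4 1 t 0 _)); exact: cz.
rewrite /probe.
apply: is_cvgD; first by apply: is_cvgMl_tmp; apply: is_cvgD; apply: is_cvgMl_tmp.
by apply: is_cvgB; [do 2?apply: is_cvgD|]; apply: is_cvgMl_tmp.
Qed.

(** The initial point only has to lie off the hyperplane where [probe]
    vanishes; here [probe] is initially [58 * beta]. *)
Lemma eADMM_rotating_diverges x z :
  eADMM_seq beta ((fun=> const_mx 1) : blocks rotating_problem) 0 x z ->
  ~ seq_converges x z.
Proof.
move=> xz /probe_cvg; apply: (linear_recurrence_not_cvg _ (7 / 4)).
- by rewrite gtr0_norm; lra.
- have [init zinit _] := xz.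
  rewrite /probe zinit !init ?inordK // !mxE.
  by rewrite gt_eqF // !mulr0 !addr0 subr0 !mulr1; move: beta0; lra.
- by move=> k; exact: probe_recurrence xz.
Qed.

End rotating.

Theorem theorem6p3 (R : realType) (m : nat) (hm : (3 <= m)%N)
    (beta : R) (hbeta : 0 < beta) :
  exists (P : problem R m) (x0 : blocks P) (z0 : 'cV[R]_(rdim P)),
    [/\ problem_hyp P,
        num_strongly_convex P = (m - 2)%N,
        exists (x : nat -> blocks P) (z : nat -> 'cV[R]_(rdim P)),
          eADMM_seq beta x0 z0 x z
      & forall (x : nat -> blocks P) (z : nat -> 'cV[R]_(rdim P)),
          eADMM_seq beta x0 z0 x z -> ~ seq_converges x z].
Proof.
case: m hm => [|[|[|n]]] // _.
exists (rotating_problem n beta), (fun=> const_mx 1), 0; split.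
- by apply: problem_hyp_quadratic => // i; exact: rotating_weight_ge0.
- by rewrite num_strongly_convex_rotating // !subSS subn0.
- apply: eADMM_seq_exists => i xn xo z.
  by apply: argmin_gs_point_exists => j; exact: rotating_curvature.
- by move=> x z; exact: eADMM_rotating_diverges.
Qed.
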